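(* Let $D=(E,\mathcal F)$ be a vf-safe delta-matroid, and let $S\subseteq E$. Then there exists $A\subseteq S$, with an ordering $e_1,\ldots,e_k$ of the elements of $A$, such that $$\omega(D^{\times|A})=\max_{B\subseteq S}\omega(D^{\times|B}),$$ and the sequence $$\omega(D),\ \omega(D^{\times|\{e_1\}}),\ \omega(D^{\times|\{e_1,e_2\}}),\ \ldots,\ \omega(D^{\times|A})$$ is non-decreasing.
   Context: A set system is a pair $D=(E,\mathcal F)$ with $E$ a finite set and $\mathcal F\subseteq 2^E$; the members of $\mathcal F$ are the feasible sets. $D$ is proper if $\mathcal F\neq\emptyset$. A delta-matroid is a proper set system such that for all $X,Y\in\mathcal F$ and every $u\in X\triangle Y$ there exists $v\in X\triangle Y$ (possibly $v=u$) with $X\triangle\{u,v\}\in\mathcal F$, where $\triangle$ is symmetric difference. For proper $D$, $r(D_{\max})$ and $r(D_{\min})$ denote the largest and smallest cardinality of a feasible set, and the width is $\omega(D)=r(D_{\max})-r(D_{\min})$. Twist: for $A\subseteq E$, $D^{\ast|A}=(E,\{F\triangle A\mid F\in\mathcal F\})$. Loop complementation: for $e\in E$, $D^{\times|e}=(E,\mathcal F')$ with $\mathcal F'=\mathcal F\,\triangle\,\{F\cup\{e\}\mid F\in\mathcal F,\ e\notin F\}$. Loop complementations on distinct elements commute, and for $A\subseteq E$, $D^{\times|A}$ is obtained by applying loop complementation to every element of $A$ (so $D^{\times|\emptyset}=D$). These operations preserve properness. A delta-matroid $D$ is vf-safe if every set system obtained from $D$ by an arbitrary finite sequence of twists and loop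 complementations (on elements or subsets of $E$) is again a delta-matroid. *)

(* Defs.v *)
From mathcomp Require Import all_boot.

Set Implicit Arguments.
Unset Strict Implicit.
Unset Printing Implicit Defensive.

(* The ground set E is the whole finite type T; a set system (E, F) on it is
   represented by its family F : {set {set T}} of feasible sets. *)

Definition symdiff (T : finType) (A B : {set T}) : {set T} :=
  (A :\: B) :|: (B :\: A).

Section SetSystems.

Variable T : finType.
Implicit Types (A F X Y : {set T}) (D : {set {set T}}) (e : T) (s : seq T).

Definition proper_system D : Prop := D <> set0.

Definition delta_matroid D : Prop :=
  proper_system D /\
  forall X Y, X \in D -> Y \in D -> forall u, u \in symdiff X Y ->
    exists2 v, v \in symdiff X Y & symdiff X [set u; v] \in D.

Definition r_max D : nat := \max_(F in D) #|F|.

(* The unit #|T| bounds every #|F|, so for proper D this is the true minimum. *)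
Definition r_min D : nat := \big[minn/#|T|]_(F in D) #|F|.

(* For proper D, r_min D <= r_max D and the subtraction is not truncated. *)
Definition width D : nat := r_max D - r_min D.

Definition twist D A : {set {set T}} := [set symdiff F A | F in D].

Definition loopc1 D e : {set {set T}} :=
  symdiff D [set F :|: [set e] | F in D & e \notin F].

(* Lemma loopcE below shows that the enumeration order is irrelevant. *)
Definition loopc D A : {set {set T}} := foldl loopc1 D (enum A).

(* Operations at an element e are the case A = [set e] (see loopc_set1). *)
Inductive vf_reachable D : {set {set T}} -> Prop :=
| vf_refl : vf_reachable D D
| vf_twist D' A : vf_reachable D D' -> vf_reachable D (twist D' A)
| vf_loopc D' A : vf_reachable D D' -> vf_reachable D (loopc D' A).

Definition vf_safe D : Prop :=
  delta_matroid D /\ forall D', vf_reachable D D' -> delta_matroid D'.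

Lemma in_symdiff (U : finType) (A B : {set U}) x :
  (x \in symdiff A B) = (x \in A) (+) (x \in B).
Proof. by rewrite !inE; case: (x \in A); case: (x \in B). Qed.

Lemma in_loopc1 D e F :
  (F \in loopc1 D e) = (F \in D) (+) ((e \in F) && (F :\ e \in D)).
Proof.
rewrite in_symdiff; congr (_ (+) _).
apply/imsetP/andP => [[G] | [eF FD]].
  by rewrite inE => /andP[GD eG] ->; rewrite setUC setU1K // setU11.
by exists (F :\ e); rewrite ?inE ?FD ?eqxx //= setUC setD1K.
Qed.

Lemma loopc1C D e f : loopc1 (loopc1 D e) f = loopc1 (loopc1 D f) e.
Proof.
have [-> // | nef] := eqVneq e f; apply/setP => F.
rewrite !in_loopc1 !inE nef eq_sym nef /= (_ : F :\ f :\ e = F :\ e :\ f).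
  by do 2![case: (_ \in F)]; do 4![case: (_ \in D)].
by rewrite !setDDl setUC.
Qed.

Lemma loopcE D A s : uniq s -> s =i A -> foldl loopc1 D s = loopc D A.
Proof.
have perm_foldl s1 s2 D0 :
    perm_eq s1 s2 -> foldl loopc1 D0 s1 = foldl loopc1 D0 s2.
  have pull t x D1 : foldl loopc1 D1 (rcons t x) = foldl loopc1 D1 (x :: t).
    by elim: t D1 => //= y t IH D1; rewrite IH /= loopc1C.
  elim: s1 s2 D0 => [|x s1 IH] s2 D0.
    by move/perm_size/esym/size0nil->.
  move=> eq12; have xs2: x \in s2 by rewrite -(perm_mem eq12) mem_head.
  case/splitPr: xs2 eq12 => t1 t2 eq12.
  rewrite -cat_rcons foldl_cat pull -foldl_cat /=; apply: IH.
  by rewrite -(perm_cons x) (permPl eq12) (perm_catCA t1 [:: x] t2).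
move=> Us sA; apply: perm_foldl; apply: uniq_perm (enum_uniq _) _ => // x.
by rewrite sA mem_enum.
Qed.

Lemma loopc_set0 D : loopc D set0 = D.
Proof. by rewrite /loopc enum_set0. Qed.

Lemma loopc_set1 D e : loopc D [set e] = loopc1 D e.
Proof. by rewrite /loopc enum_set1. Qed.

End SetSystems.

(* Main.v *)
(** Loop complementation preserves the minimum size of a feasible set, so only
    the maximum size r matters. If some maximum feasible set F of D avoids e,
    then F + e is feasible in D^{x e}, so r grows by one, and every maximum
    feasible set of D^{x e} is a maximum feasible set of D with e added.
    Complementing greedily along such elements e of S thus gives a
    non-decreasing sequence in which the elements already used lie in all
    maximum feasible sets, and it stops at a D^{x A} all of whose maximum
    feasible sets contain S. In a delta-matroid every feasible set lies in a
    maximum one, so then |F :|: S| <= r (D^{x A}) for all feasible F; as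
    complementing inside S does not change the family of sets F :|: S, the
    right-hand side bounds r (D^{x B}) for all subsets B of S. *)
Require Import Defs.
From mathcomp Require Import all_boot.

Set Implicit Arguments.
Unset Strict Implicit.
Unset Printing Implicit Defensive.

Section LoopComplementation.

Variable T : finType.
Implicit Types (A F G S : {set T}) (D : {set {set T}}) (e : T) (s : seq T).

Definition max_feasible D F := (F \in D) && (#|F| == r_max D).

Lemma loopc1K D e : loopc1 (loopc1 D e) e = D.
Proof.
apply/setP => F; rewrite !in_loopc1 !inE eqxx /= addbF.
by case: (e \in F) => /=; rewrite ?addbF // addbK.
Qed.

Lemma in_loopc1_sub D e F :
  F \in loopc1 D e -> F \in D \/ e \in F /\ F :\ e \in D.
Proof.
by rewrite in_loopc1; case: (F \in D); [left | right; apply/andP].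
Qed.

Lemma leq_r_max D F : F \in D -> #|F| <= r_max D.
Proof. exact: leq_bigmax_cond. Qed.

Lemma r_min_leq D F : F \in D -> r_min D <= #|F|.
Proof.
rewrite /r_min -big_filter => FD.
have: F \in [seq G <- index_enum {set T} | G \in D].
  by rewrite mem_filter FD mem_index_enum.
elim: (filter _ _) => //= G s IH; rewrite inE big_cons geq_min.
by case/predU1P => [<- | /IH ->]; rewrite ?leqnn ?orbT.
Qed.

Lemma r_min_glb D m :
  m <= #|T| -> (forall F, F \in D -> m <= #|F|) -> m <= r_min D.
Proof.
by move=> mT mD; apply: (big_ind (leq m)) => // a b ma mb; rewrite leq_min ma.
Qed.

(** A feasible set of [loopc1 D e] lies in [D], perhaps after deleting [e], so the minimum cannot
    drop; by the involution [loopc1K] it cannot rise either. *)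
Lemma r_min_loopc1 D e : r_min (loopc1 D e) = r_min D.
Proof.
have le D' : r_min D' <= r_min (loopc1 D' e).
  apply: r_min_glb => [|F /in_loopc1_sub[/r_min_leq // | [_ FD]]].
    by rewrite /r_min; elim/big_rec: _ => // F m _; apply: leq_trans (geq_minr _ _).
  exact: leq_trans (r_min_leq FD) (subset_leq_card (subD1set _ _)).
by apply/eqP; rewrite eqn_leq le -{2}(loopc1K D e) le.
Qed.

Lemma r_min_foldl D s : r_min (foldl (@loopc1 T) D s) = r_min D.
Proof. by elim: s D => //= e s IH D; rewrite IH r_min_loopc1. Qed.

(** Feasible sets change only at [e], which [S] absorbs; [loopc1K] gives the reverse inclusion. *)
Lemma unions_loopc1 D S e : e \in S ->
  [set F :|: S | F in loopc1 D e] = [set F :|: S | F in D].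
Proof.
move=> eS.
have sub D' : [set F :|: S | F in loopc1 D' e] \subset [set F :|: S | F in D'].
  apply/subsetP => _ /imsetP[F /in_loopc1_sub[FD | [eF FD]] ->].
    exact: imset_f.
  apply/imsetP; exists (F :\ e) => //; apply/setP => x; rewrite !inE.
  by have [-> | //] := eqVneq x e; rewrite eS !orbT.
by apply/eqP; rewrite eqEsubset sub -{1}(loopc1K D e) sub.
Qed.

Lemma unions_foldl D S s : {subset s <= S} ->
  [set F :|: S | F in foldl (@loopc1 T) D s] = [set F :|: S | F in D].
Proof.
elim: s D => //= e s IH D sS; rewrite IH => [|x xs]; last first.
  by apply: sS; rewrite inE xs orbT.
by rewrite unions_loopc1 // sS ?mem_head.
Qed.

Lemma max_feasible_exists D F : F \in D -> exists G, max_feasible D G.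
Proof.
move=> FD; have D0 : 0 < #|D| by apply/card_gt0P; exists F.
have [G GD rG] := eq_bigmax_cond (fun F : {set T} => #|F|) D0.
by exists G; rewrite /max_feasible GD /r_max rG eqxx.
Qed.

Lemma sub_max_feasible D F : delta_matroid D -> F \in D ->
  exists2 G, max_feasible D G & F \subset G.
Proof.
case=> _ exch FD; have [G0 mG0] := max_feasible_exists FD.
case: (arg_minnP (fun G => #|F :\: G|) mG0) => G /andP[GD /eqP rG] minG.
exists G; first by rewrite /max_feasible GD rG eqxx.
apply/negPn/negP => /subsetPn[u uF uG].
have [|v] := exch G F GD FD u; first by rewrite in_symdiff uF (negPf uG).
rewrite in_symdiff => vGF HD.
(* If [v] is in [G], swapping it for [u] keeps the size but misses less of [F]; otherwise, even for
   [v = u], the exchange enlarges [G]. Both contradict the choice of [G]. *)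
have [vG | vG] := boolP (v \in G).
  have neq : v != u by apply: contraNneq uG => <-.
  have eqH : symdiff G [set u; v] = u |: G :\ v.
    apply/setP => x; rewrite in_symdiff !inE.
    have [-> | _] := eqVneq x u; first by rewrite (negPf uG) eq_sym neq.
    by have [-> | _] := eqVneq x v; rewrite ?vG ?addbF.
  have rH : #|symdiff G [set u; v]| = r_max D.
    by rewrite eqH cardsU1 !inE (negPf uG) andbF -rG (cardsD1 v G) vG.
  have := minG _ (introT andP (conj HD (introT eqP rH))).
  apply/negP; rewrite -ltnNge eqH; apply: proper_card.
  have vF : v \notin F by rewrite vG /= in vGF.
  apply/properP; split; last by exists u; rewrite !inE ?uG // eqxx.
  apply/subsetP => x; rewrite !inE negb_or => /andP[/andP[_ xvG] xF].
  rewrite xF andbT; apply: contra xvG => ->; rewrite andbT.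
  by apply: contraNneq vF => <-.
have : G \proper symdiff G [set u; v].
  apply/properP; split; last by exists u; rewrite // in_symdiff !inE eqxx (negPf uG).
  apply/subsetP => x xG; rewrite in_symdiff xG !inE.
  by apply/norP; split; apply: contraTneq xG => ->.
by move/proper_card; rewrite rG ltnNge leq_r_max.
Qed.

Lemma r_max_loopc1_gt D e F : max_feasible D F -> e \notin F ->
  r_max D < r_max (loopc1 D e).
Proof.
case/andP=> FD /eqP rF eF.
have rFe : #|e |: F| = (r_max D).+1 by rewrite cardsU1 eF rF.
rewrite -rFe; apply: leq_r_max; rewrite in_loopc1 setU11 setU1K // FD /=.
(* [e |: F] is too large to lie in [D], so the symmetric difference does not cancel it. *)
by rewrite addbT; apply/negP => /leq_r_max; rewrite rFe ltnn.
Qed.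

(** Such a [G] is too large to lie in [D], so it arose by adding [e]; removing [e] costs only one
    element. *)
Lemma max_feasible_loopc1 D e G : r_max D < r_max (loopc1 D e) ->
  max_feasible (loopc1 D e) G -> e \in G /\ max_feasible D (G :\ e).
Proof.
move=> lt_r /andP[/in_loopc1_sub GD /eqP rG].
case: GD => [/leq_r_max | [eG GD]]; first by rewrite rG leqNgt lt_r.
split=> //; rewrite /max_feasible GD eqn_leq leq_r_max //=.
by move: lt_r; rewrite -rG (cardsD1 e G) eG.
Qed.

(** [A] collects the elements already used: an element of [S] missed by some maximum feasible set is
    outside [A], so [S :\: A] shrinks and nothing repeats. *)
Lemma greedy_loopc1 D S A :
    (forall F, max_feasible D F -> A \subset F) ->
  exists s, [/\ uniq s, {subset s <= S :\: A},
    path leq (width D) (map (@width T) (scanl (@loopc1 T) D s))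
    & forall F, max_feasible (foldl (@loopc1 T) D s) F -> S \subset F].
Proof.
have [n] := ubnP #|S :\: A|; elim: n D A => // n IH D A /ltnSE ltn AD.
have [/existsP[F /andP[mF /subsetPn[e eS eF]]] | noF] :=
    boolP [exists F, max_feasible D F && ~~ (S \subset F)]; last first.
  exists [::]; split=> // F mF; apply: contraR noF => nSF.
  by apply/existsP; exists F; rewrite mF.
have eSA : e \in S :\: A.
  by rewrite inE eS andbT; apply: contra eF; apply/subsetP/AD.
have lt_r := r_max_loopc1_gt mF eF.
have eqSA : S :\: (e |: A) = (S :\: A) :\ e by rewrite setUC setDDl.
have [||s [Us sS ps ms]] := IH (loopc1 D e) (e |: A).
- by apply: leq_trans ltn; rewrite [leqRHS](cardsD1 e) eSA eqSA.
- move=> G /(max_feasible_loopc1 lt_r)[eG /AD AG].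
  by rewrite subUset sub1set eG (subset_trans AG) ?subD1set.
exists (e :: s); split=> //=.
- by rewrite Us andbT; apply/negP => /sS; rewrite eqSA !inE eqxx.
- by move=> x /predU1P[-> // | /sS]; rewrite eqSA => /setD1P[].
- by rewrite ps andbT /width r_min_loopc1 leq_sub2r // ltnW.
Qed.

(** Links the prefixes [take i es] of the theorem to the [scanl] trace of the greedy run. *)
Lemma map_foldl_take (U V : Type) (h : U -> V -> U) x (s : seq V) :
  [seq foldl h x (take i s) | i <- iota 0 (size s).+1] = x :: scanl h x s.
Proof.
elim: s x => // y s IH x; rewrite [scanl _ _ _]/= -IH.
rewrite -[iota 0 _]/(0 :: iota (1 + 0) (size s).+1) iotaDl.
by rewrite map_cons -map_comp.
Qed.

Lemma delta_matroid_foldl D s :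
  vf_safe D -> delta_matroid (foldl (@loopc1 T) D s).
Proof.
case=> _; apply; elim/last_ind: s => [|s e IH]; first exact: vf_refl.
by rewrite foldl_rcons -loopc_set1; apply: vf_loopc.
Qed.

Lemma r_max_foldl_le D S s t :
    delta_matroid (foldl (@loopc1 T) D s) -> {subset s <= S} ->
    {subset t <= S} ->
    (forall F, max_feasible (foldl (@loopc1 T) D s) F -> S \subset F) ->
  r_max (foldl (@loopc1 T) D t) <= r_max (foldl (@loopc1 T) D s).
Proof.
move=> dm sS tS maxS; apply/bigmax_leqP => F FD.
(* Some [G] feasible after [s] has the same union with [S]; a maximum feasible set above [G]
   contains [S], hence also [F]. *)
have : F :|: S \in [set F :|: S | F in foldl (@loopc1 T) D t].
  exact: imset_f.
rewrite (unions_foldl D tS) -(unions_foldl D sS) => /imsetP[G GD eqFG].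
have [H mH GH] := sub_max_feasible dm GD.
have /andP[_ /eqP<-] := mH; apply: subset_leq_card.
by rewrite (subset_trans (subsetUl F S)) // eqFG subUset GH maxS.
Qed.

End LoopComplementation.

Theorem theorem4p9 (T : finType) (D : {set {set T}}) (S : {set T}) :
  vf_safe D ->
  exists A : {set T}, exists es : seq T,
    [/\ A \subset S,
        uniq es,
        es =i A,
        width (loopc D A) = \max_(B : {set T} | B \subset S) width (loopc D B)
      & sorted leq
          [seq width (loopc D [set:: take i es]) | i <- iota 0 (size es).+1]].
Proof.
move=> vfD.
have [|es [Ues esS pes mes]] := @greedy_loopc1 T D S set0.
  by move=> F _; apply: sub0set.
rewrite setD0 in esS.
have sub : [set:: es] \subset S by apply/subsetP => x; rewrite inE => /esS.
exists [set:: es], es; split=> // [x | |]; first by rewrite inE.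
- apply/eqP; rewrite eqn_leq (leq_bigmax_cond (F := fun B => width (loopc D B))) //=.
  apply/bigmax_leqP => B /subsetP BS.
  rewrite -(loopcE (A := [set:: es]) D Ues) => [|x]; last by rewrite inE.
  (* Both minima are [r_min D], so only the maxima are compared. *)
  rewrite /width !r_min_foldl leq_sub2r //.
  apply: r_max_foldl_le esS _ mes; first exact: delta_matroid_foldl.
  by move=> x; rewrite mem_enum => /BS.
- rewrite (eq_map (g := fun i => width (foldl (@loopc1 T) D (take i es)))).
    by rewrite (map_comp (@width T)) map_foldl_take.
  by move=> i; rewrite -(loopcE D (take_uniq i Ues)) // => x; rewrite inE.
Qed.
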